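(* For every real number $\epsilon < \frac{2}{3}$ there exist a constant $c > 0$ and win-lose bimatrix games with $m \le n$ and $n$ arbitrarily large such that, in each of these games, every $\epsilon$-well-supported Nash equilibrium $(\mathbf{p}, \mathbf{q})$ satisfies $\max(|\mathrm{supp}(\mathbf{p})|, |\mathrm{supp}(\mathbf{q})|) \ge c \sqrt[3]{\log n}$. That is, every $\epsilon$-well-supported Nash equilibrium has supports of cardinality $\Omega(\sqrt[3]{\log n})$.
   Context: A bimatrix game is given by two $m \times n$ payoff matrices $A$ (row player) and $B$ (column player), with $m \le n$. It is win-lose if all entries of $A$ and $B$ lie in $\{0,1\}$. A pair of mixed strategies $(\mathbf{p}, \mathbf{q})$ (probability vectors over rows and columns, respectively) is an $\epsilon$-well-supported Nash equilibrium if every row $i$ in the support of $\mathbf{p}$ satisfies $\mathbf{e}_i^T A \mathbf{q} \ge \max_\ell \mathbf{e}_\ell^T A \mathbf{q} - \epsilon$, and every column $j$ in the support of $\mathbf{q}$ satisfies $\mathbf{p}^T B \mathbf{e}_j \ge \max_\ell \mathbf{p}^T B \mathbf{e}_\ell - \epsilon$. Here $\mathrm{supp}$ denotes the support, i.e. the set of pure strategies played with positive probability. *)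

(* Defs.v *)
From HB Require Import structures.
From mathcomp Require Import all_boot all_order all_algebra.
From mathcomp Require Import all_classical all_reals all_analysis.
Set Implicit Arguments. Unset Strict Implicit. Unset Printing Implicit Defensive.
Import Order.TTheory GRing.Theory Num.Theory.
Local Open Scope ring_scope.

Section Games.
Variable R : realType.

Definition is_prob (k : nat) (p : 'I_k -> R) : Prop :=
  (forall i, 0 <= p i) /\ \sum_(i < k) p i = 1.

Definition win_lose (m n : nat) (A : 'M[R]_(m, n)) : Prop :=
  forall i j, A i j = 0 \/ A i j = 1.

Definition row_payoff (m n : nat) (A : 'M[R]_(m, n)) (q : 'I_n -> R) (i : 'I_m) : R :=
  \sum_(j < n) A i j * q j.

Definition col_payoff (m n : nat) (B : 'M[R]_(m, n)) (p : 'I_m -> R) (j : 'I_n) : R :=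
  \sum_(i < m) p i * B i j.

Definition supp (k : nat) (p : 'I_k -> R) : {set 'I_k} := [set i | p i != 0].

Definition eps_WSNE (eps : R) (m n : nat) (A B : 'M[R]_(m, n))
    (p : 'I_m -> R) (q : 'I_n -> R) : Prop :=
  [/\ is_prob p, is_prob q,
      (forall i, i \in supp p -> forall l,
          row_payoff A q l - eps <= row_payoff A q i) &
      (forall j, j \in supp q -> forall l,
          col_payoff B p l - eps <= col_payoff B p j)].

End Games.

(* Main.v *)
(** Take a loopless oriented graph D in which any k^2 vertices have a common
    in-neighbour.  Rows are the vertices of D and columns the k-tuples of
    vertices; a column c points to a row r when r occurs in c, and r points to c
    when r dominates all of c in D.  Any k rows (columns) are dominated by some
    column (row), so an equilibrium with supports of size at most k has best
    payoff 1 on each side, and all supported vertices have weighted out-degree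
    at least 1 - eps > 1/3.  A bipartite digraph with this property has a
    directed 2- or 4-cycle, which here would give a loop or a 2-cycle in D.
    A random D works with 2^(6 k^2) vertices, hence log n is O(k^3). *)

Require Import Defs.
From HB Require Import structures.
From mathcomp Require Import all_boot all_order all_algebra.
From mathcomp Require Import zify ring lra.
Set Implicit Arguments. Unset Strict Implicit. Unset Printing Implicit Defensive.
Import Order.TTheory GRing.Theory Num.Theory.

(** * Existence of a dominating oriented graph, by counting *)

(* Overwriting w by the pattern on B i maps the colourings counted so far to
   those matching the pattern, with fibres of size at most 2 ^ b. *)
Lemma card_avoid_patterns (T : finType) (I : eqType) (B : I -> {set T})
    (pat : I -> T -> bool) (b : nat) (s : seq I) :
  uniq s -> {in s &, forall i j, i != j -> [disjoint B i & B j]} ->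
  (forall i, #|B i| <= b) ->
  #|[set w : {ffun T -> bool} | all (fun i => [exists t in B i, w t != pat i t]) s]|
    * (2 ^ b) ^ size s <= (2 ^ b).-1 ^ size s * 2 ^ #|T|.
Proof.
move=> + + Bb; elim: s => [|i s IHs] /=.
  move=> _ _; rewrite !expn0 muln1 mul1n.
  by apply: leq_trans (max_card _) _; rewrite card_ffun card_bool.
move=> /andP[i_s us] Bdisj.
have {}IHs := IHs us (fun j l js ls => Bdisj j l (mem_behead (s := i :: s) js)
  (mem_behead (s := i :: s) ls)).
pose ok w j := [exists t in B j, w t != pat j t].
set P := [set w : {ffun T -> bool} | all _ s] in IHs.
set Q := [set w : {ffun T -> bool} | _].
pose O := [set w in P | ~~ ok w i].
have PQO : #|P| = #|Q| + #|O|.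
  rewrite -(cardsID [set w : {ffun T -> bool} | ok w i] P); congr (_ + _); apply: eq_card => w.
    by rewrite !inE andbC.
  by rewrite !inE andbC.
pose over (w : {ffun T -> bool}) : {ffun T -> bool} :=
  [ffun t => if t \in B i then pat i t else w t].
(* [over] forgets [w] on [B i]; the second component records what is lost, a subset of [B i], whence
   fibres of size at most [2 ^ b]. *)
pose code w := (over w, [set t in B i | w t]).
have code_inj : injective code.
  move=> w w' [/ffunP ww' /setP trww']; apply/ffunP => t.
  move: (ww' t) (trww' t); rewrite !ffunE !inE; by case: (t \in B i).
have PO : #|P| <= #|O| * 2 ^ b.
  rewrite -(card_imset _ code_inj).
  apply: (@leq_trans #|setX O (powerset (B i))|); last first.
    by rewrite cardsX leq_mul2l card_powerset leq_pexp2l ?orbT// Bb.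
  apply/subset_leq_card/subsetP => _ /imsetP[w Pw ->].
  rewrite !inE /=; apply/andP; split; last by apply/subsetP => t; rewrite inE => /andP[].
  apply/andP; split; last first.
    by apply/existsPn => t; rewrite ffunE; case: (t \in B i); rewrite ?eqxx.
  move: Pw; rewrite inE => /allP Pw; apply/allP => j js.
  have /existsP[t /andP[tj wt]] := Pw _ js; apply/existsP; exists t.
  rewrite tj ffunE ifN//; apply: contraL tj => ti.
  have /pred0P/(_ t) : [disjoint B i & B j].
    apply: Bdisj; rewrite ?mem_head ?in_cons ?js ?orbT//.
    by apply: contraNneq i_s => ->.
  by rewrite /= ti /= => ->.
have Qle : #|Q| * 2 ^ b <= #|P| * (2 ^ b).-1.
  have : 0 < 2 ^ b by rewrite expn_gt0.
  move: PO; rewrite PQO; case: (2 ^ b) => // z; nia.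
rewrite !expnS mulnA; apply: leq_trans (leq_mul Qle (leqnn _)) _.
by rewrite mulnAC [(2 ^ b).-1 * _]mulnC -[leqRHS]mulnA [(2 ^ b).-1 * _]mulnC mulnA leq_mul.
Qed.

(** Bernoulli's inequality (1 + 1/m)^n >= 1 + n/m with denominators cleared; n = m yields the factor
    2 below. *)
Lemma expn_succ_ge (m n : nat) : m ^ n * (m + n) <= m.+1 ^ n * m.
Proof.
elim: n => [|n IH]; first by rewrite !expn0 addn0.
rewrite !expnS -(mulnA m.+1).
apply: leq_trans (leq_mul (leqnn m.+1) IH).
by set v := m ^ n; nia.
Qed.

Lemma double_expn_pred (m : nat) : 0 < m -> 2 * m ^ m <= m.+1 ^ m.
Proof.
case: m => // m _; rewrite -(@leq_pmul2r m.+1)//.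
by apply: leq_trans (expn_succ_ge m.+1 m.+1); set v := _ ^ _; nia.
Qed.

(** Each of [X] candidate vertices fails to dominate a given s-tuple with probability at most 1 -
    2^(-2s), independently, and there are (2^(6s))^s tuples. *)
Lemma union_bound_numeric (s X : nat) : 0 < s -> 2 ^ (6 * s) - s <= X ->
  (2 ^ (2 * s)).-1 ^ X * (2 ^ (6 * s)) ^ s < (2 ^ (2 * s)) ^ X.
Proof.
move=> s_gt0 X_ge; set m := (2 ^ (2 * s)).-1.
have m1 : 2 ^ (2 * s) = m.+1 by rewrite prednK// expn_gt0.
have m_gt0 : 0 < m by rewrite -ltnS -m1 (leq_trans (ltn_expl 1 (isT : 1 < 2)))// leq_pexp2l//; lia.
(* Each block of [m] factors gains a factor 2 by [double_expn_pred]; [t] blocks fit into [X], and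
   2^t just beats the number of tuples. *)
pose t := (6 * s * s).+1.
have mtX : m * t <= X.
  apply: leq_trans X_ge.
  have e6 : 2 ^ (6 * s) = 2 ^ (2 * s) * 2 ^ (4 * s) by rewrite -expnD -mulnDl.
  have h4 : 6 * s * s + 2 <= 2 ^ (4 * s).
    rewrite expnM; case: s s_gt0 {m m1 m_gt0 t e6} => // s _.
    elim: s => // s IH; rewrite expnS.
    by apply: leq_trans (leq_mul (leqnn _) IH); nia.
  have ms : s <= m by rewrite -ltnS -m1; apply: leq_trans (ltn_expl s (isT : 1 < 2)) _; rewrite leq_pexp2l//; lia.
  rewrite e6 m1; move: h4; rewrite /t; set z := 2 ^ _; set v := 6 * s * s => h4.
  have : m.+1 * (v + 2) <= m.+1 * z by rewrite leq_mul.
  by nia.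
rewrite -expnM m1 -(subnK mtX) !(expnD _ (X - m * t)).
have lt1 : 2 ^ (6 * s * s) < 2 ^ t by rewrite ltn_exp2l.
have le1 : 2 ^ t * m ^ (m * t) <= m.+1 ^ (m * t).
  by rewrite !expnM -expnMn leq_exp2r// double_expn_pred.
have lt2 : m ^ (m * t) * 2 ^ (6 * s * s) < m.+1 ^ (m * t).
  by apply: leq_trans le1; rewrite mulnC ltn_pmul2r// expn_gt0 m_gt0.
rewrite -mulnA; apply: leq_ltn_trans (leq_mul (_ : _ <= m.+1 ^ (X - m * t)) (leqnn _)) _.
  by case: (X - m * t) => // e; rewrite leq_exp2r.
by rewrite ltn_pmul2l// expn_gt0.
Qed.

Lemma dominating_oriented_graph (s : nat) : 0 < s ->
  exists D : rel 'I_(2 ^ (6 * s)),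
    (forall x y, ~~ (D x y && D y x)) /\
    (forall S : {set 'I_(2 ^ (6 * s))}, #|S| <= s ->
       exists x, forall y, y \in S -> D x y).
Proof.
move=> s_gt0; set M := 2 ^ _; pose V := 'I_M.
(* All pairs between [x] and [S], both ways. The pattern [t.1 == x] asks for every arc from [x] and
   none back; for distinct [x] outside [S] these sets are disjoint. *)
pose pairs (S : {set V}) (x : V) := setX [set x] S :|: setX S [set x].
pose bad (S : {set V}) := [set w : {ffun V * V -> bool} |
  all (fun x => [exists t in pairs S x, w t != (t.1 == x)]) (enum (~: S))].
pose img (f : {ffun 'I_s -> V}) := [set f i | i : 'I_s].
have img_card f : #|img f| <= s.
  by apply: leq_trans (leq_imset_card _ _) _; rewrite card_ord.
have bad_lt f : M ^ s * #|bad (img f)| < 2 ^ #|{: V * V}|.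
  set S := img f.
  have pairs_disj : {in enum (~: S) &, forall x x', x != x' -> [disjoint pairs S x & pairs S x']}.
    move=> x x'; rewrite !mem_enum !inE => xS x'S xx'; apply/pred0P => -[c d].
    apply/negbTE; rewrite /= !inE /=.
    apply/negP => /andP[] /orP[] /andP[] h1 h2 /orP[] /andP[] h3 h4.
    - by move: xx'; rewrite -(eqP h1) -(eqP h3) eqxx.
    - by move: x'S; rewrite -(eqP h4) h2.
    - by move: xS; rewrite -(eqP h2) h4.
    - by move: xx'; rewrite -(eqP h2) -(eqP h4) eqxx.
  have pairs_card x : #|pairs S x| <= 2 * s.
    apply: leq_trans (leq_card_setU _ _) _.
    by rewrite !cardsX cards1 mul1n muln1 addnn -mul2n leq_mul2l img_card.
  have := card_avoid_patterns (fun x t => t.1 == x) (enum_uniq _) pairs_disj pairs_card.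
  rewrite -/(bad S); set X := size _ => card_bad.
  have X_ge : M - s <= X.
    by rewrite /X -cardE cardsCs setCK card_ord leq_sub2l// img_card.
  have num := union_bound_numeric s_gt0 X_ge.
  have N_gt0 : 0 < (2 ^ (2 * s)) ^ X by rewrite !expn_gt0.
  rewrite -(ltn_pmul2r N_gt0) -mulnA.
  apply: leq_ltn_trans (leq_mul (leqnn _) card_bad) _.
  by rewrite mulnA [2 ^ #|_| * _]mulnC ltn_pmul2r ?expn_gt0// mulnC.
have M_gt0 : 0 < M by rewrite expn_gt0.
have [w good] : exists w, w \notin \bigcup_f bad (img f).
  apply/existsP; apply: contraT => /existsPn all_bad.
  have cover : [set: {ffun V * V -> bool}] \subset \bigcup_f bad (img f).
    by apply/subsetP => w _; have := all_bad w; rewrite negbK.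
  have := subset_leq_card cover; rewrite cardsT card_ffun card_bool => le1.
  have le2 : #|\bigcup_f bad (img f)| <= \sum_f #|bad (img f)|.
    apply: (big_ind2 (fun (A : {set _}) n => #|A| <= n)) => [|A a B b leA leB|//].
      by rewrite cards0.
    by apply: leq_trans (leq_card_setU _ _) _; exact: leq_add.
  have : M ^ s * 2 ^ #|{: V * V}| < M ^ s * 2 ^ #|{: V * V}|.
    apply: leq_ltn_trans (leq_mul (leqnn _) (leq_trans le1 le2)) _.
    rewrite big_distrr /=.
    apply: (@leq_ltn_trans (M ^ s * (2 ^ #|{: V * V}|).-1)); last first.
      by rewrite ltn_pmul2l ?ltn_predL expn_gt0 ?M_gt0.
    have {2}-> : M ^ s = #|{ffun 'I_s -> V}| by rewrite card_ffun !card_ord.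
    rewrite -sum_nat_const leq_sum// => f _.
    by have := bad_lt f; case: (2 ^ _).
  by rewrite ltnn.
(* Keeping only unreciprocated arcs makes an arbitrary relation oriented. *)
exists (fun x y => w (x, y) && ~~ w (y, x)); split.
  by move=> x y; case: (w (x, y)); case: (w (y, x)).
move=> S S_le.
(* The default vertex pads the tuple when [S] is small; [img f] may then exceed [S], and dominating
   [img f] suffices. *)
pose f : {ffun 'I_s -> V} := [ffun i => nth (Ordinal M_gt0) (enum S) (nat_of_ord i)].
have : w \notin bad (img f) by apply: contra good => wf; apply/bigcupP; exists f.
rewrite inE => /allPn[x]; rewrite mem_enum inE => xS /existsPn xP; exists x => y yS.
have yf : y \in img f.
  have ys : index y (enum S) < s by apply: leq_trans S_le; rewrite cardE index_mem mem_enum.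
  by apply/imsetP; exists (Ordinal ys) => //; rewrite ffunE /= nth_index ?mem_enum.
have yx : (y == x) = false by apply: contraNF xS => /eqP <-.
have := xP (x, y); have := xP (y, x).
rewrite !inE /= yf eqxx yx /= !negbK => /eqP -> /eqP ->.
by [].
Qed.

(** * The bipartite digraph on vertices and tuples *)

Lemma dominating_bipartite_digraph (k : nat) : (0 < k)%N ->
  exists (m n : nat) (E : 'I_m -> 'I_n -> bool) (F : 'I_n -> 'I_m -> bool),
    [/\ (0 < m <= n)%N, n = (2 ^ (6 * k ^ 3))%N,
      (forall S : {set 'I_n}, (#|S| <= k)%N -> exists x, forall y, y \in S -> E x y),
      (forall S : {set 'I_m}, (#|S| <= k)%N -> exists y, forall x, x \in S -> F y x) &
      (forall x y, ~~ (E x y && F y x)) /\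
      (forall x y x' y', ~~ [&& E x y, F y x', E x' y' & F y' x])].
Proof.
move=> k_gt0; have s_gt0 : (0 < k * k)%N by rewrite muln_gt0 k_gt0.
have [D [Dor Ddom]] := dominating_oriented_graph s_gt0.
set M := (2 ^ _)%N in D Dor Ddom.
have M_gt0 : (0 < M)%N by rewrite expn_gt0.
pose C := {ffun 'I_k -> 'I_M}.
pose col (j : 'I_#|{: C}|) : C := enum_val j.
have nE : #|{: C}| = (2 ^ (6 * k ^ 3))%N.
  by rewrite card_ffun !card_ord -expnM; congr (2 ^ _)%N; rewrite !expnS expn0; lia.
exists M, #|{: C}|, (fun x y => [forall i, D x (col y i)]), (fun y x => [exists i, col y i == x]).
split=> //.
- rewrite M_gt0 nE leq_exp2l// !expnS expn0; nia.
- move=> S S_le.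
  have [|x xP] := Ddom [set col u.1 u.2 | u in setX S [set: 'I_k]].
    apply: leq_trans (leq_imset_card _ _) _.
    by rewrite cardsX cardsT card_ord leq_mul2r S_le orbT.
  exists x => y yS; apply/forallP => i; apply: xP.
  by apply/imsetP; exists (y, i); rewrite // !inE yS.
- move=> S S_le.
  pose f : C := [ffun i => nth (Ordinal M_gt0) (enum S) (nat_of_ord i)].
  exists (enum_rank f) => x xS; apply/existsP.
  have xk : (index x (enum S) < k)%N.
    by apply: leq_trans S_le; rewrite cardE index_mem mem_enum.
  by exists (Ordinal xk); rewrite /col enum_rankK ffunE /= nth_index ?mem_enum.
(* A path row-column-row projects to an arc of [D], so 2-cycles become loops and 4-cycles become
   2-cycles. *)
have DEF x y x' : [forall i, D x (col y i)] -> [exists i, col y i == x'] -> D x x'.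
  by move=> /forallP Dx /existsP[i /eqP <-].
split=> [x y|x y x' y'].
  by apply/negP => /andP[/DEF h /h xx]; have := Dor x x; rewrite xx.
apply/negP => /and4P[/DEF h /h xx' /DEF h' /h' x'x].
by have := Dor x x'; rewrite xx' x'x.
Qed.

(** * Short cycles in weighted bipartite digraphs *)

Local Open Scope ring_scope.

Section BipartiteCH.
Variable R : realFieldType.
Variable a : R.
Hypothesis a_gt : 1 / 3 < a.

(* The first three hypotheses give u <= h (1 - h) / a; inserting this in the last
   and dividing by d leaves a^2 + a h <= h (1 - h), a quadratic in h without real
   solutions when a > 1/3. *)
Lemma mass_inequalities_absurd (u d h S : R) :
  a <= d -> u * a <= S -> S <= h * (1 - h) ->
  S + a * d <= u * d + h * (1 - h - d) -> False.
Proof.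
move=> d_ge S_ge S_le S_le2; have a3 := a_gt.
have u_le : u * a <= h * (1 - h) by exact: le_trans S_le.
have key : u * (d - a) * a <= h * (1 - h) * (d - a).
  by rewrite mulrAC ler_wpM2r// subr_ge0.
have key2 : d * (a * a + a * h - h * (1 - h)) <= 0.
  have : (u * a + a * d) * a <= (u * d + h * (1 - h - d)) * a.
    apply: ler_wpM2r; last by apply: le_trans S_le2; rewrite lerD2r.
    lra.
  by nra.
have : a * a + a * h - h * (1 - h) <= 0.
  by rewrite -(pmulr_rle0 _ (_ : 0 < d)) //; lra.
(* Completing the square: the quadratic equals this square plus 3/4 (a - 1/3)(a + 1). *)
have := sqr_ge0 (h - (1 - a) / 2); rewrite expr2.
have : 0 < (a - 1 / 3) * (a + 1) by apply: mulr_gt0; lra.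
by nra.
Qed.

(* The row x0 has maximal in-weight h among all vertices.  With U = N+(N+(x0))
   the mass S of the arcs leaving U is bounded twice: they avoid N-(x0), as there
   are no 4-cycles, and every column receives at most h; moreover the arcs between
   U and N+(x0) have total mass at most u * d, as there are no 2-cycles. *)
Lemma max_indegree_row (X Y : finType) (E : X -> Y -> bool) (F : Y -> X -> bool)
    (p : X -> R) (q : Y -> R) (x0 : X) :
  (forall x, 0 <= p x) -> (forall y, 0 <= q y) -> \sum_y q y = 1 ->
  (forall x y, ~~ (E x y && F y x)) ->
  (forall x y x' y', ~~ [&& E x y, F y x', E x' y' & F y' x]) ->
  (forall x, p x != 0 -> a <= \sum_y q y * (E x y)%:R) ->
  (forall y, q y != 0 -> a <= \sum_x p x * (F y x)%:R) ->
  p x0 != 0 ->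
  (forall y, q y != 0 ->
     \sum_x p x * (E x y)%:R <= \sum_y q y * (F y x0)%:R) ->
  False.
Proof.
move=> p_ge0 q_ge0 q1 no2 no4 outX outY px0 maxi.
set h := \sum_y q y * (F y x0)%:R in maxi.
pose U x := [exists y, E x0 y && F y x].
pose u := \sum_x p x * (U x)%:R.
pose d := \sum_y q y * (E x0 y)%:R.
pose S := \sum_x \sum_y p x * q y * ((U x)%:R * (E x y)%:R).
have Uno x y : U x -> E x y -> F y x0 = false.
  move=> /existsP[z /andP[Ez Fz]] Exy; apply/negbTE.
  by have := no4 x0 z x y; rewrite Ez Fz Exy.
have d_ge : a <= d by exact: outX.
have S_ge : u * a <= S.
  rewrite /u mulr_suml ler_sum// => x _.
  rewrite (eq_bigr (fun y => p x * (U x)%:R * (q y * (E x y)%:R))); last by move=> y _; ring.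
  rewrite -mulr_sumr; have [->|/outX ax] := eqVneq (p x) 0; first by rewrite !mul0r.
  by rewrite ler_wpM2l// mulr_ge0.
(* Applied to the columns outside N-(x0), and then to those outside both N-(x0) and N+(x0). *)
have weightedE (g : Y -> R) : (forall y, 0 <= g y) ->
    \sum_x \sum_y p x * q y * (g y * (E x y)%:R) <= h * \sum_y q y * g y.
  move=> g_ge0; rewrite exchange_big mulr_sumr ler_sum//= => y _.
  rewrite (eq_bigr (fun x => q y * g y * (p x * (E x y)%:R))); last by move=> x _; ring.
  rewrite -mulr_sumr mulrC; have [->|/maxi ay] := eqVneq (q y) 0; first by rewrite mul0r !mulr0.
  by rewrite ler_wpM2r// mulr_ge0.
have S_le : S <= h * (1 - h).
  rewrite (_ : 1 - h = \sum_y q y * (1 - (F y x0)%:R)); last first.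
    by rewrite -[in LHS]q1 /h -sumrB; apply: eq_bigr => y _; ring.
  apply: (le_trans _ (weightedE _ _)); last by move=> y; case: (F y x0) => /=; lra.
  apply: ler_sum => x _; apply: ler_sum => y _; rewrite ler_wpM2l ?mulr_ge0//.
  case Ux: (U x); case Exy: (E x y); rewrite ?(Uno _ _ Ux Exy) /=; try lra.
  by case: (F y x0) => /=; lra.
(* Arcs leaving N+(x0) have mass at least [a * d] and end in U. Any other arc from U meets a column
   with [g y = 1], by [Uno], unless it enters N+(x0). *)
have S_le2 : S + a * d <= u * d + h * (1 - h - d).
  pose g y : R := 1 - (F y x0)%:R - (E x0 y)%:R.
  have g_ge0 y : 0 <= g y.
    by rewrite /g; have := no2 x0 y; case: (F y x0); case: (E x0 y) => //= _; lra.
  have -> : 1 - h - d = \sum_y q y * g y.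
    by rewrite -[in LHS]q1 /h /d -!sumrB; apply: eq_bigr => y _; rewrite /g; ring.
  have le1 : a * d <= \sum_x \sum_y p x * q y * ((E x0 y)%:R * (F y x)%:R).
    rewrite exchange_big /d mulr_sumr ler_sum//= => y _.
    rewrite (eq_bigr (fun x => q y * (E x0 y)%:R * (p x * (F y x)%:R))); last by move=> x _; ring.
    rewrite -mulr_sumr mulrC; have [->|/outY ay] := eqVneq (q y) 0; first by rewrite !mul0r.
    by rewrite ler_wpM2l// mulr_ge0.
  have -> : u * d = \sum_x \sum_y p x * q y * ((U x)%:R * (E x0 y)%:R).
    rewrite /u /d mulr_suml; apply: eq_bigr => x _; rewrite mulr_sumr.
    by apply: eq_bigr => y _; ring.
  apply: (le_trans (lerD (lexx S) le1)); apply: (le_trans _ (lerD (lexx _) (weightedE _ g_ge0))).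
  rewrite /S -!big_split ler_sum//= => x _; rewrite -!big_split ler_sum//= => y _.
  rewrite -!mulrDr ler_wpM2l ?mulr_ge0//.
  have n2 := no2 x y; have n2' := no2 x0 y.
  have UF : E x0 y -> F y x -> U x by move=> e f; apply/existsP; exists y; rewrite e.
  have UE := Uno x y; rewrite /g.
  move: n2 n2' UF UE; case: (U x); case: (E x y); case: (E x0 y); case: (F y x);
    case: (F y x0) => //= n2 n2' UF UE; try lra; try by have := UF isT isT.
  all: try by have := UE isT isT.
exact: (mass_inequalities_absurd d_ge S_ge S_le S_le2).
Qed.

(** The hypotheses are symmetric in the two sides, so whichever side has the supported vertex of
    largest in-weight provides the [x0] of [max_indegree_row]. *)
Lemma bipartite_caccetta_haggkvist4 (X Y : finType)
    (E : X -> Y -> bool) (F : Y -> X -> bool) (p : X -> R) (q : Y -> R) :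
  (forall x, 0 <= p x) -> \sum_x p x = 1 ->
  (forall y, 0 <= q y) -> \sum_y q y = 1 ->
  (forall x, p x != 0 -> a <= \sum_y q y * (E x y)%:R) ->
  (forall y, q y != 0 -> a <= \sum_x p x * (F y x)%:R) ->
  (exists x y, E x y && F y x) \/
  (exists x y x' y', [&& E x y, F y x', E x' y' & F y' x]).
Proof.
move=> p_ge0 p1 q_ge0 q1 outX outY.
case: (boolP [exists x, exists y, E x y && F y x]) => [/existsP[x /existsP[y xy]]|no2].
  by left; exists x, y.
case: (boolP [exists x, exists y, exists x', exists y', [&& E x y, F y x', E x' y' & F y' x]])
  => [/existsP[x /existsP[y /existsP[x' /existsP[y' xy]]]]|no4].
  by right; exists x, y, x', y'.
have {}no2 x y : ~~ (E x y && F y x).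
  by apply: contra no2 => xy; apply/existsP; exists x; apply/existsP; exists y.
have {}no4 x y x' y' : ~~ [&& E x y, F y x', E x' y' & F y' x].
  apply: contra no4 => xy; apply/existsP; exists x; apply/existsP; exists y.
  by apply/existsP; exists x'; apply/existsP; exists y'.
exfalso.
have supp_ex (Z : finType) (w : Z -> R) : \sum_z w z = 1 -> exists z, w z != 0.
  move=> w1; apply/existsP; apply: contraT => /existsPn w0.
  have := oner_neq0 R; rewrite -w1 big1 ?eqxx// => z _.
  by apply/eqP; move: (w0 z); rewrite negbK.
have [x1 px1] := supp_ex _ _ p1; have [y1 qy1] := supp_ex _ _ q1.
pose inX x := \sum_y q y * (F y x)%:R.
pose inY y := \sum_x p x * (E x y)%:R.
case: (@arg_maxP _ _ _ x1 (fun x => p x != 0) inX px1) => x0 px0 maxX.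
case: (@arg_maxP _ _ _ y1 (fun y => q y != 0) inY qy1) => y0 qy0 maxY.
have [le_yx|/ltW le_xy] := lerP (inY y0) (inX x0).
  apply: (@max_indegree_row X Y E F p q x0) => // y qy.
  by apply: le_trans le_yx; exact: maxY.
apply: (@max_indegree_row Y X F E q p y0) => //.
- by move=> y x; rewrite andbC.
- by move=> y x y' x'; have := no4 x y' x' y; apply: contra => /and4P[-> -> -> ->].
- by move=> x px; apply: le_trans le_xy; exact: maxX.
Qed.

End BipartiteCH.

(* Imported only here: the classical_sets notations would shadow those of finset. *)
From mathcomp Require Import all_classical all_reals all_analysis.

(** * Equilibrium supports and their growth *)

Lemma sum_supp_weight (R : realType) (n : nat) (q : 'I_n -> R) (P : 'I_n -> bool) :
  \sum_j q j = 1 -> (forall j, j \in supp q -> P j) -> \sum_j q j * (P j)%:R = 1.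
Proof.
move=> q1 Pq; rewrite -[RHS]q1; apply: eq_bigr => j _; have [->|qj] := eqVneq (q j) 0; first by rewrite mul0r.
have Pj : P j by apply: Pq; rewrite /supp inE.
by rewrite Pj mulr1.
Qed.

Lemma WSNE_large_support (R : realType) (eps : R) (m n k : nat)
    (E : 'I_m -> 'I_n -> bool) (F : 'I_n -> 'I_m -> bool)
    (p : 'I_m -> R) (q : 'I_n -> R) :
  eps < 2 / 3 ->
  (forall S : {set 'I_n}, (#|S| <= k)%N -> exists x, forall y, y \in S -> E x y) ->
  (forall S : {set 'I_m}, (#|S| <= k)%N -> exists y, forall x, x \in S -> F y x) ->
  (forall x y, ~~ (E x y && F y x)) ->
  (forall x y x' y', ~~ [&& E x y, F y x', E x' y' & F y' x]) ->
  eps_WSNE eps (\matrix_(i, j) (E i j)%:R) (\matrix_(i, j) (F j i)%:R) p q ->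
  (k < maxn #|supp p| #|supp q|)%N.
Proof.
move=> eps_lt domE domF no2 no4 [[p_ge0 p1] [q_ge0 q1] brp brq].
rewrite ltnNge geq_max; apply/negP => /andP[/domF[y0 Fy0] /domE[x0 Ex0]].
have row_payoffE x : row_payoff (\matrix_(i, j) (E i j)%:R) q x = \sum_y q y * (E x y)%:R.
  by apply: eq_bigr => y _; rewrite mxE mulrC.
have col_payoffE y : col_payoff (\matrix_(i, j) (F j i)%:R) p y = \sum_x p x * (F y x)%:R.
  by apply: eq_bigr => x _; rewrite mxE.
have a_gt : 1 / 3 < 1 - eps by lra.
have outX x : p x != 0 -> 1 - eps <= \sum_y q y * (E x y)%:R.
  move=> px; have := brp x; rewrite /supp inE => /(_ px x0).
  by rewrite !row_payoffE (@sum_supp_weight _ _ q (E x0)).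
have outY y : q y != 0 -> 1 - eps <= \sum_x p x * (F y x)%:R.
  move=> qy; have := brq y; rewrite /supp inE => /(_ qy y0).
  by rewrite !col_payoffE (@sum_supp_weight _ _ p (F y0)).
have [[x [y xy]]|[x [y [x' [y' xy]]]]] :=
  bipartite_caccetta_haggkvist4 a_gt p_ge0 p1 q_ge0 q1 outX outY.
- by have := no2 x y; rewrite xy.
- by have := no4 x y x' y'; rewrite xy.
Qed.

Theorem theorem1 (R : realType) (eps : R) (heps : eps < 2 / 3) :
  exists c : R, 0 < c /\
    forall N : nat, exists (m n : nat) (A B : 'M[R]_(m, n)),
      [/\ (0 < m <= n)%N, (N <= n)%N, win_lose A, win_lose B &
        forall (p : 'I_m -> R) (q : 'I_n -> R), eps_WSNE eps A B p q ->
          c * powR (ln (n%:R)) (3^-1) <= (maxn #|supp p| #|supp q|)%:R].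
Proof.
(* Since ln 2 <= 1, ln n = 6 k^3 ln 2 <= (2k)^3, so half the cube root of ln n is at most k. *)
exists 2^-1; split=> [|N]; first by rewrite invr_gt0.
pose k := N.+1.
have [m [n [E [F [mn nE domE domF [no2 no4]]]]]] := @dominating_bipartite_digraph k isT.
exists m, n, (\matrix_(i, j) (E i j)%:R), (\matrix_(i, j) (F j i)%:R).
have win01 (b : bool) : b%:R = 0 :> R \/ b%:R = 1 :> R by case: b; [right|left].
split=> //; [|by move=> i j; rewrite mxE|by move=> i j; rewrite mxE|].
  rewrite nE; apply: leq_trans (ltnW (ltn_expl _ (isT : (1 < 2)%N))) _.
  by rewrite leq_exp2l// /k !expnS expn0; nia.
move=> p q /(WSNE_large_support heps domE domF no2 no4)/ltnW k_le.
apply: (@le_trans _ _ k%:R); last by rewrite ler_nat.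
have ln_ge0' : 0 <= ln (n%:R : R) by rewrite ln_ge0// ler1n nE expn_gt0.
have ln_le : ln (n%:R : R) <= (2 * k%:R) ^+ 3.
  rewrite nE natrX lnXn// -(mulr_natr (ln _)).
  have ln2_le1 : ln (2 : R) <= 1 by rewrite -[2]/(1 + 1) le_ln1Dx//; lra.
  have k3 : (0 : R) <= k%:R ^+ 3 by rewrite exprn_ge0.
  rewrite natrM natrX exprMn; nra.
have : powR (ln (n%:R : R)) 3^-1 <= powR ((2 * k%:R) ^+ 3) 3^-1.
  by rewrite ge0_ler_powR ?nnegrE ?invr_ge0 ?exprn_ge0 ?mulr_ge0.
rewrite -powR_mulrn ?mulr_ge0// -powRrM divff ?pnatr_eq0// powRr1 ?mulr_ge0//; lra.
Qed.
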